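(* Let $\underline{P}:\mathcal{D}_{LIN}\to\mathbb{R}$ be $2$-convex. Define $$\mathcal{A}'=\{B(X-x)+Y: X|B\in\mathcal{D}_{LIN},\ x<\underline{P}(X|B),\ Y\in\mathcal{X}^{\succeq}\}.$$ 1) The set $\mathcal{A}'$ is such that: a) $\mathcal{A}'+\mathcal{X}^{\succeq}\subseteq\mathcal{A}'$; b) $\mathcal{A}'\cap\mathcal{X}^{\preceq}=\emptyset$ if and only if $\underline{P}$ is $1$-AUL; c) $\underline{P}(X|B)=\sup\{x\in\mathbb{R}:B(X-x)\in\mathcal{A}'\}$ for all $X|B\in\mathcal{D}_{LIN}$. 2) If $\underline{P}$ is centered, then $\mathcal{R}(B)^{\succ}\subseteq\mathcal{A}'$ for all $B\in\mathcal{B}^{\varnothing}$; if $\underline{P}$ is $1$-AUL and $\mathcal{R}(B)^{\succ}\subseteq\mathcal{A}'$ for all $B\in\mathcal{B}^{\varnothing}$, then $\underline{P}$ is centered.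
   Context: Fix a partition $\mathbb{P}$ of the sure event $\Omega$ into atoms $\omega$. A gamble is a bounded function $X:\mathbb{P}\to\mathbb{R}$. Events are subsets of $\mathbb{P}$, identified with their indicators; $\vee$ denotes union. For a gamble $X$ and an event $B\neq\varnothing$, the conditional gamble $X|B$ is the restriction of $X$ to $B$; thus $\sup\{X|B\}=\sup_{\omega\in B}X(\omega)$ and $\inf\{X|B\}=\inf_{\omega\in B}X(\omega)$. Let $\mathcal{X}$ be a linear space of gambles and $\mathcal{B}\subset\mathcal{X}$ a set of (indicators of) events, with $\Omega\in\mathcal{B}$ and $BX\in\mathcal{X}$ for all $B\in\mathcal{B}$, $X\in\mathcal{X}$. Put $\mathcal{B}^{\varnothing}=\mathcal{B}\setminus\{\varnothing\}$, $\mathcal{D}_{LIN}=\{X|B: X\in\mathcal{X}, B\in\mathcal{B}^{\varnothing}\}$, $\mathcal{X}^{\succeq}=\{X\in\mathcal{X}:\inf X\geq 0\}$, $\mathcal{X}^{\preceq}=\{X\in\mathcal{X}:\sup X\leq 0\}$. For $B\in\mathcal{B}^{\varnothing}$ let $\mathcal{R}(B)=\{X\in\mathcal{X}:BX=X\}$ and $\mathcal{R}(B)^{\succ}=\{X\in\mathcal{R}(B):\inf\{X|B\}>0\}$. Sums of sets are Minkowski sums. $\underline{P}:\mathcal{D}\to\mathbb{R}$ is $2$-convex on $\mathcal{D}$ iff for all $X_0|B_0,X_1|B_1\in\mathcal{D}$, $\sup\{B_1(X_1-\underline{P}(X_1|B_1))-B_0(X_0-\underline{P}(X_0|B_0))\,|\,B_0\vee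 B_1\}\geq 0$. It is centered iff for every $X|B\in\mathcal{D}$, $0|B\in\mathcal{D}$ and $\underline{P}(0|B)=0$. It is $1$-AUL ($1$-Avoiding Uniform Loss) iff for all $X_0|B_0\in\mathcal{D}$ and all $s_0>0$, $\sup\{s_0B_0(X_0-\underline{P}(X_0|B_0))|B_0\}\geq 0$. *)

(* Defs.v *)
From mathcomp Require Import all_boot all_order all_algebra.
From mathcomp Require Import all_classical all_reals all_analysis.
Set Implicit Arguments.
Unset Strict Implicit.
Unset Printing Implicit Defensive.
Import Order.TTheory GRing.Theory Num.Theory.
Import numFieldNormedType.Exports.
Local Open Scope classical_set_scope.
Local Open Scope ring_scope.

(* The points of [T] are the atoms of the partition; an event is a [set T]
   with indicator [\1_B]. *)
Definition gamble (T : Type) (R : realType) (X : T -> R) : Prop := bounded_fun X.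

Definition linear_space_of_gambles (T : Type) (R : realType)
    (XX : set (T -> R)) : Prop :=
  [/\ XX `<=` [set X | gamble X],
      XX (cst 0),
      (forall X Y, XX X -> XX Y -> XX (X \+ Y)) &
      (forall (a : R) X, XX X -> XX (cst a \* X))].

(* [cond_gamble X B] is X|B, the restriction of X to B as a partial function
   with domain B: two conditional gambles are equal iff they have the same
   conditioning event and agree on it. *)
Definition cond_gamble (T : Type) (R : realType) (X : T -> R) (B : set T) :
  T -> option R := patch (fun=> None) B (Some \o X).

(* Suprema and infima of a gamble on an event. They are only meaningful for
   bounded X and nonempty B, as [sup] and [inf] in [R] are 0 otherwise. *)
Definition sup_on (T : Type) (R : realType) (X : T -> R) (B : set T) : R :=
  sup (X @` B).
Definition inf_on (T : Type) (R : realType) (X : T -> R) (B : set T) : R :=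
  inf (X @` B).

(* The gamble B(X - x). *)
Definition gain (T : Type) (R : realType) (X : T -> R) (B : set T) (x : R) :
  T -> R := \1_B \* (X \- cst x).

Definition minkowski_sum (T : Type) (R : realType) (A C : set (T -> R)) : set (T -> R) :=
  [set X \+ Y | X in A & Y in C].

Section Domain.
Variables (T : Type) (R : realType) (XX : set (T -> R)) (BB : set (set T)).

Definition proper_events : set (set T) := BB `\` [set set0].

Definition D_LIN : set (T -> option R) :=
  [set cond_gamble X B | X in XX & B in proper_events].

Definition nonneg_gambles : set (T -> R) :=
  [set X | XX X /\ 0 <= inf_on X [set: T]].

Definition nonpos_gambles : set (T -> R) :=
  [set X | XX X /\ sup_on X [set: T] <= 0].

Definition supported_gambles (B : set T) : set (T -> R) :=
  [set X | XX X /\ \1_B \* X = X].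

Definition pos_supported_gambles (B : set T) : set (T -> R) :=
  [set X | supported_gambles B X /\ 0 < inf_on X B].

End Domain.

(* A map D -> R is represented by a total function of which only the values on
   D matter. *)
Section Prevision.
Variables (T : Type) (R : realType).
Variables (D : set (T -> option R)) (P : (T -> option R) -> R).

Definition two_convex : Prop :=
  forall (X0 : T -> R) (B0 : set T) (X1 : T -> R) (B1 : set T),
    D (cond_gamble X0 B0) -> D (cond_gamble X1 B1) ->
    0 <= sup_on (gain X1 B1 (P (cond_gamble X1 B1))
                 \- gain X0 B0 (P (cond_gamble X0 B0))) (B0 `|` B1).

Definition centered : Prop :=
  forall (X : T -> R) (B : set T), D (cond_gamble X B) ->
    D (cond_gamble (cst 0) B) /\ P (cond_gamble (cst 0) B) = 0.

Definition one_AUL : Prop :=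
  forall (X0 : T -> R) (B0 : set T) (s0 : R),
    D (cond_gamble X0 B0) -> 0 < s0 ->
    0 <= sup_on (cst s0 \* gain X0 B0 (P (cond_gamble X0 B0))) B0.

End Prevision.

Definition A_prime (T : Type) (R : realType) (XX : set (T -> R)) (BB : set (set T))
    (P : (T -> option R) -> R) : set (T -> R) :=
  [set Z | exists (X : T -> R) (B : set T) (x : R) (Y : T -> R),
     [/\ D_LIN XX BB (cond_gamble X B), x < P (cond_gamble X B),
         nonneg_gambles XX Y & Z = gain X B x \+ Y]].

(* Main.v *)
(* If B(X - x) dominates C(Z - z) with z < P(Z|C), then x > P(X|B) would make
   C(Z - P(Z|C)) - B(X - P(X|B)) at most a negative constant on the union of B
   and C, against 2-convexity; this gives (c). Similarly, B(X - x) <= 0 for some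
   x < P(X|B) means exactly that B(X - P(X|B)) is at most a negative constant on
   B, which gives (b). For part 2, a gamble of R(B) with infimum m > 0 on B
   dominates mB = B(0 - (-m)), and having B(0 - (-e)) in A' for all e > 0 means
   P(0|B) >= 0 by (c), while 1-AUL gives P(0|B) <= 0. *)
Require Import Defs.
From mathcomp Require Import all_boot all_order all_algebra.
From mathcomp Require Import all_classical all_reals all_analysis.
From mathcomp Require Import lra.
Import Order.TTheory GRing.Theory Num.Theory.
Import numFieldNormedType.Exports.
Local Open Scope classical_set_scope.
Local Open Scope ring_scope.

(** * Pointwise bounds for gambles, gains and conditional gambles *)

Section Bounds.
Set Implicit Arguments.
Unset Strict Implicit.
Context {T : Type} {R : realType}.
Implicit Types (X : T -> R) (B : set T) (c : R).

Lemma inf_on_le X B w : gamble X -> B w -> inf_on X B <= X w.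
Proof.
move=> /bounded_fun_has_lbound[m mX] Bw; apply: ge_inf; last by exists w.
by exists m => _ [v _ <-]; apply: mX; exists v.
Qed.

Lemma le_sup_on X B w : gamble X -> B w -> X w <= sup_on X B.
Proof.
move=> /bounded_fun_has_ubound[M XM] Bw; apply: ub_le_sup; last by exists w.
by exists M => _ [v _ <-]; apply: XM; exists v.
Qed.

Lemma le_inf_on X B c : B !=set0 -> (forall w, B w -> c <= X w) ->
  c <= inf_on X B.
Proof.
move=> [w Bw] cX; apply: lb_le_inf; first by exists (X w), w.
by move=> _ [v Bv <-]; exact: cX.
Qed.

Lemma sup_on_le X B c : B !=set0 -> (forall w, B w -> X w <= c) ->
  sup_on X B <= c.
Proof.
move=> [w Bw] Xc; apply: ge_sup; first by exists (X w), w.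
by move=> _ [v Bv <-]; exact: Xc.
Qed.

Lemma gain_in X B x w : B w -> gain X B x w = X w - x.
Proof. by move=> Bw; rewrite /gain /= indicE mem_set// mul1r. Qed.

Lemma gain_notin X B x w : ~ B w -> gain X B x w = 0.
Proof. by move=> Bw; rewrite /gain /= indicE memNset// mul0r. Qed.

(** Membership in [D_LIN] yields only some representative of X|B; this transfers its properties to
    [B] and to the values of [X] on [B]. *)
Lemma cond_gamble_inj (X X' : T -> R) (B B' : set T) :
  cond_gamble X B = cond_gamble X' B' -> B = B' /\ {in B, X =1 X'}.
Proof.
move=> /(congr1 (@^~ _))eqXB; split=> [|w wB].
  apply/seteqP; split=> w Bw; have := eqXB w; rewrite /cond_gamble /patch;
    rewrite (mem_set Bw); by case: ifPn => // /set_mem.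
have := eqXB w; rewrite /cond_gamble /patch wB; by case: ifPn => // _ [].
Qed.

End Bounds.

Section DesirableGambles.
Set Implicit Arguments.
Unset Strict Implicit.
Context {R : realType} {T : Type} {XX : set (T -> R)} {BB : set (set T)}.
Hypothesis hT : [set: T] !=set0.
Hypothesis hXX : linear_space_of_gambles XX.
Hypothesis hBBXX : forall B : set T, BB B -> XX \1_B.
Hypothesis hmul : forall (B : set T) (X : T -> R),
  BB B -> XX X -> XX (\1_B \* X).
Variable P : (T -> option R) -> R.

Local Notation D := (D_LIN XX BB).
Local Notation A' := (A_prime XX BB P).
Implicit Types (X Y Z : T -> R) (B : set T).

Lemma XX_gamble X : XX X -> gamble X.
Proof. by case: hXX => + _ _ _; apply. Qed.

(** Members of [XX] are bounded, so the infimum is a true lower bound and not the default value 0 of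
    [inf]. *)
Lemma nonneg_gamblesP Y :
  nonneg_gambles XX Y <-> XX Y /\ forall w, 0 <= Y w.
Proof.
split=> -[XY Y0]; split=> //; last by apply: le_inf_on => // w _; exact: Y0.
by move=> w; apply: (le_trans Y0); apply: inf_on_le => //; exact: XX_gamble.
Qed.

Lemma nonpos_gamblesP Y :
  nonpos_gambles XX Y <-> XX Y /\ forall w, Y w <= 0.
Proof.
split=> -[XY Y0]; split=> //; last by apply: sup_on_le => // w _; exact: Y0.
by move=> w; apply: le_trans Y0; apply: le_sup_on => //; exact: XX_gamble.
Qed.

Lemma D_LIN_proper X B : D (cond_gamble X B) -> proper_events BB B.
Proof. by move=> [Z _ [C pC /cond_gamble_inj[<-]]]. Qed.

Lemma D_LIN_neq0 X B : D (cond_gamble X B) -> B !=set0.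
Proof. by move=> /D_LIN_proper[_ /eqP/set0P]. Qed.

(* [X] itself need not belong to [XX]: only its restriction to [B] matters. *)
Lemma XX_gain X B x : D (cond_gamble X B) -> XX (gain X B x).
Proof.
case=> Z XZ [C [BC _] /cond_gamble_inj[<- ZX]].
have [_ _ XXD XXZ] := hXX.
have -> : gain X C x = (\1_C \* Z) \+ (cst (- x) \* \1_C).
  apply/funext => w /=; have [Cw|Cw] := pselect (C w).
    by rewrite gain_in// indicE mem_set// mul1r mulr1 ZX// inE.
  by rewrite gain_notin// indicE memNset// mul0r mulr0 addr0.
by apply: XXD; [exact: hmul|apply: XXZ; exact: hBBXX].
Qed.

(** * Upward closure of [A'] and avoidance of uniform loss *)

Lemma A_prime_gain X B x : D (cond_gamble X B) -> x < P (cond_gamble X B) ->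
  A' (gain X B x).
Proof.
move=> DXB xP; exists X, B, x, (cst 0); split=> //.
  by apply/nonneg_gamblesP; split=> //; case: hXX.
by apply/funext => w /=; rewrite addr0.
Qed.

Lemma A_prime_addr : minkowski_sum A' (nonneg_gambles XX) `<=` A'.
Proof.
move=> _ [_ [X [B [x [Y [DXB xP /nonneg_gamblesP[XY Y0] ->]]]]]
  [Y' /nonneg_gamblesP[XY' Y'0] <-]].
exists X, B, x, (Y \+ Y'); split=> //; last first.
  by apply/funext => w /=; rewrite addrA.
apply/nonneg_gamblesP; split; first by case: hXX => _ _ + _; apply.
by move=> w /=; rewrite addr_ge0.
Qed.

Lemma A_prime_nonpos :
  A' `&` nonpos_gambles XX = set0 <-> one_AUL D P.
Proof.
have [_ _ _ XXZ] := hXX.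
split=> [A0 X B s DXB s0|aul].
- rewrite leNgt; apply/negP => S0.
  set p := P _ in S0 *; set S := sup_on _ _ in S0.
  have gainS w : B w -> s * (X w - p) <= S.
    move=> Bw; rewrite -(@gain_in _ _ X B) //.
    apply: (@le_sup_on _ _ (cst s \* gain X B p)) => //.
    by apply: XX_gamble; apply: XXZ; exact: XX_gain.
  (* On [B], X - p <= S / s, so raising the price from p to p + S / s leaves a nonpositive gain; as
     S < 0, this price is still below p. *)
  suff : (A' `&` nonpos_gambles XX) (gain X B (p + S / s)) by rewrite A0.
  split.
    by apply: A_prime_gain => //; rewrite gtrDl pmulr_llt0 // invr_gt0.
  apply/nonpos_gamblesP; split; first exact: XX_gain.
  move=> w; have [Bw|Bw] := pselect (B w); last by rewrite gain_notin.
  by rewrite gain_in// opprD addrA subr_le0 ler_pdivlMr// mulrC gainS.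
- rewrite -subset0 => _ [[X [B [x [Y [DXB xP /nonneg_gamblesP[_ Y0] ->]]]]]
    /nonpos_gamblesP[_ XY0]].
  have := aul X B 1 DXB ltr01; apply/negP; rewrite -ltNge.
  (* On [B], X - x <= -Y <= 0, hence X - P(X|B) <= x - P(X|B). *)
  apply: (@le_lt_trans _ _ (x - P (cond_gamble X B))); last by rewrite subr_lt0.
  apply: sup_on_le; first exact: D_LIN_neq0 DXB.
  move=> w Bw; have /= := XY0 w; have := Y0 w.
  by rewrite /= mul1r !gain_in//; lra.
Qed.

(** * The supremum formula from 2-convexity *)

Hypothesis hP : two_convex D P.

Lemma A_prime_gain_le X B x : D (cond_gamble X B) -> A' (gain X B x) ->
  x <= P (cond_gamble X B).
Proof.
move=> DXB [Z [C [z [Y [DZC zP /nonneg_gamblesP[_ Y0] eqZY]]]]].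
rewrite leNgt; apply/negP => Px.
have := hP DXB DZC; apply/negP; rewrite -ltNge.
set p := P _ in Px *; set q := P _ in zP *.
(* C(Z - q) - B(X - p) = -Y - (q - z)C - (x - p)B. Both coefficients are positive and each point of
   the union lies in [B] or in [C], so at least their minimum is subtracted there. *)
apply: (@le_lt_trans _ _ (- Num.min (x - p) (q - z))); last first.
  by rewrite oppr_lt0 lt_min !subr_gt0 Px.
have [v Bv] := D_LIN_neq0 DXB.
apply: sup_on_le => [|w BCw]; first by exists v; left.
have := congr1 (@^~ w) eqZY; have := Y0 w => /=.
have m1 : Num.min (x - p) (q - z) <= x - p by rewrite ge_min lexx.
have m2 : Num.min (x - p) (q - z) <= q - z by rewrite ge_min lexx orbT.
have [Bw|Bw] := pselect (B w); have [Cw|Cw] := pselect (C w).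
- by rewrite !(gain_in _ _ Bw) !(gain_in _ _ Cw); lra.
- by rewrite !(gain_in _ _ Bw) !(gain_notin _ _ Cw); lra.
- by rewrite !(gain_notin _ _ Bw) !(gain_in _ _ Cw); lra.
- by case: BCw.
Qed.

(** With an extended supremum, equality to a real number also says that the set is nonempty and
    bounded above, which the real [sup] with its default 0 would not. *)
Lemma ereal_sup_A_prime X B : D (cond_gamble X B) ->
  ereal_sup [set x%:E | x in [set x : R | A' (gain X B x)]]
  = (P (cond_gamble X B))%:E.
Proof.
move=> DXB; apply/eqP; rewrite eq_le; apply/andP; split.
  by apply: ge_ereal_sup => _ [x Ax <-]; rewrite lee_fin A_prime_gain_le.
apply/lee_subgt0Pr => e e0; apply: ereal_sup_ubound.
exists (P (cond_gamble X B) - e) => //=.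
by apply: A_prime_gain => //; rewrite gtrBl.
Qed.

(** * Centering and positive gambles supported on an event *)

Lemma D_LIN0 B : proper_events BB B -> D (cond_gamble (cst 0) B).
Proof. by move=> pB; exists (cst 0); [case: hXX|exists B]. Qed.

Lemma centered_pos_supported B : centered D P -> proper_events BB B ->
  pos_supported_gambles XX B `<=` A'.
Proof.
move=> cP pB Z [[XZ BZ] m0]; have D0 := D_LIN0 pB; have [_ P0] := cP _ _ D0.
set m := inf_on Z B in m0.
have eqZ w : ~ B w -> Z w = 0.
  by move=> Bw; rewrite -BZ /= indicE memNset// mul0r.
have [_ _ XXD XXZ] := hXX.
(* The remainder Z - mB is nonnegative: Z >= m on [B] and Z = 0 outside. *)
exists (cst 0), B, (- m), (Z \+ (cst (- m) \* \1_B)); split=> //.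
- by rewrite P0 oppr_lt0.
- apply/nonneg_gamblesP; split.
    by apply: XXD => //; apply: XXZ; apply: hBBXX; case: pB.
  move=> w /=; have [Bw|Bw] := pselect (B w).
    rewrite indicE mem_set// mulr1 subr_ge0.
    by apply: inf_on_le => //; exact: XX_gamble.
  by rewrite indicE memNset// mulr0 addr0 eqZ.
- apply/funext => w /=; have [Bw|Bw] := pselect (B w).
    by rewrite gain_in// indicE mem_set//=; lra.
  by rewrite gain_notin// indicE memNset//=; lra.
Qed.

Lemma pos_supported_centered : one_AUL D P ->
  (forall B, proper_events BB B -> pos_supported_gambles XX B `<=` A') ->
  centered D P.
Proof.
move=> aul RA X B DXB; have pB := D_LIN_proper DXB; have D0 := D_LIN0 pB.
have B0 := D_LIN_neq0 DXB.
split=> //; apply/eqP; rewrite eq_le; apply/andP; split.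
  (* On [B] the gain of 0|B is the constant -P(0|B), so its supremum there is -P(0|B). *)
  have := aul (cst 0) B 1 D0 ltr01; rewrite -oppr_ge0 => /le_trans; apply.
  by apply: sup_on_le => // w Bw; rewrite /= mul1r gain_in// sub0r.
(* The gain of 0|B at price -e is eB, whose infimum on [B] is positive; its membership in [A'] gives
   -e <= P(0|B). *)
apply/ler_addgt0Pr => e e0; rewrite -lerBlDr sub0r.
apply: A_prime_gain_le => //; apply: (RA _ pB); split; first split.
- exact: XX_gain.
- by apply/funext => w; rewrite /= /gain /= indicE; case: (_ \in _);
    rewrite ?(mul1r, mul0r).
- apply: (lt_le_trans e0); apply: le_inf_on => // w Bw.
  by rewrite gain_in//= sub0r opprK.
Qed.

End DesirableGambles.

Theorem proposition20 (R : realType) (T : Type) (hT : [set: T] !=set0)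
  (XX : set (T -> R)) (BB : set (set T))
  (hXX : linear_space_of_gambles XX)
  (hBBXX : forall B : set T, BB B -> XX \1_B)
  (hOmega : BB [set: T])
  (hmul : forall (B : set T) (X : T -> R), BB B -> XX X -> XX (\1_B \* X))
  (P : (T -> option R) -> R)
  (hP : two_convex (D_LIN XX BB) P) :
  (minkowski_sum (A_prime XX BB P) (nonneg_gambles XX) `<=` A_prime XX BB P
   /\ (A_prime XX BB P `&` nonpos_gambles XX = set0 <-> one_AUL (D_LIN XX BB) P)
   /\ (forall (X : T -> R) (B : set T), D_LIN XX BB (cond_gamble X B) ->
         ereal_sup [set x%:E | x in [set x : R | A_prime XX BB P (gain X B x)]]
         = (P (cond_gamble X B))%:E))
  /\ ((centered (D_LIN XX BB) P ->
         forall B : set T, proper_events BB B ->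
           pos_supported_gambles XX B `<=` A_prime XX BB P)
      /\ (one_AUL (D_LIN XX BB) P ->
         (forall B : set T, proper_events BB B ->
           pos_supported_gambles XX B `<=` A_prime XX BB P) ->
         centered (D_LIN XX BB) P)).
Proof.
split; split.
- exact: A_prime_addr.
- split; first exact: A_prime_nonpos.
  by move=> X B; exact: ereal_sup_A_prime.
- by move=> cP B; exact: centered_pos_supported.
- exact: pos_supported_centered.
Qed.
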